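(* Let $\Psi:\mathrm{Bun}_G(\mathbb{A}^2/\mathbb{G}_m)\to\mathsf{Gr}_0=G[t^{-1}]_1$ be the Braverman--Finkelberg bijection, and transport the natural action of $N_{\mathrm{GL}(2)}(\mathbb{G}_m)$ on $\mathrm{Bun}_G(\mathbb{A}^2/\mathbb{G}_m)$ to $\mathsf{Gr}_0$ via $\Psi$. Then: (1) for any $\alpha,\beta\in\mathbb{C}^\times$, the element $\begin{pmatrix}\alpha&0\\0&\beta\end{pmatrix}\in\mathrm{GL}(2)$ acts on $\mathsf{Gr}_0$ by $g(t^{-1})\mapsto g(\alpha\beta t^{-1})$; (2) the element $\begin{pmatrix}0&1\\1&0\end{pmatrix}\in\mathrm{GL}(2)$ acts on $\mathsf{Gr}_0$ by $g(t^{-1})\mapsto g(t^{-1})^{-1}$. Consequently, the element $\begin{pmatrix}0&1\\-1&0\end{pmatrix}\in\mathrm{SL}(2)$ acts on $\mathsf{Gr}_0$ via the involution $\iota$ given by $\iota(g(t^{-1}))=g(-t^{-1})^{-1}$.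
   Context: $G$ is a simply connected semisimple algebraic group over $\mathbb{C}$. $G[t,t^{-1}]$ means $G(\mathbb{C}[t,t^{-1}])$, and similarly for other polynomial or Laurent polynomial rings. $G[t^{-1}]_1:=\ker(G[t^{-1}]\to G,\ t^{-1}\mapsto 0)$. $\mathsf{Gr}:=G[t,t^{-1}]/G[t]$ is the affine Grassmannian and $\mathsf{Gr}_0:=G[t^{-1}]_1G[t]/G[t]\subset\mathsf{Gr}$, identified with $G[t^{-1}]_1$ via $g\mapsto gG[t]$. $\mathbb{G}_m$ is regarded as the subgroup of matrices $\mathrm{diag}(z,z^{-1})$ in $\mathrm{SL}(2)$; $N_{\mathrm{GL}(2)}(\mathbb{G}_m)$ is generated by the diagonal matrices and $\begin{pmatrix}0&1\\1&0\end{pmatrix}$. Moduli space. $\mathrm{Bun}_G(\mathbb{A}^2)$ is the moduli space of principal $G$-bundles on $\mathbb{P}^2$ with a trivialization on the line at infinity $\mathbb{P}^2\smallsetminus\mathbb{A}^2$; equivalently, of pairs $(\mathcal{F},\Phi)$ where $\mathcal{F}$ is a principal $G$-bundle on $\mathbb{P}^1\times\mathbb{P}^1$ and $\Phi$ is a trivialization of $\mathcal{F}$ on $(\mathbb{P}^1\times\mathbb{P}^1)\smallsetminus\mathbb{A}^2$. We use the second model, with coordinates $t,u$ on the two factors; $\mathrm{GL}(2)$ (in this model, $N_{\mathrm{GL}(2)}(\mathbb{G}_m)$) acts via its action on the base. Explicitly, gluing trivial bundles on $U_{00}=\mathbb{A}^1\times\mathbb{A}^1$, $U_{01}=\mathbb{A}^1\times(\mathbb{P}^1\smallsetminus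 0)$, $U_{10}=(\mathbb{P}^1\smallsetminus 0)\times\mathbb{A}^1$, $U_{11}=(\mathbb{P}^1\smallsetminus 0)\times(\mathbb{P}^1\smallsetminus 0)$ gives $\mathrm{Bun}_G(\mathbb{A}^2)\cong Z/H$, where: - A subscript $1$ with superscript $t$ (resp. $u$; resp. $t,u$) denotes the kernel of the specialization $t^{-1}\mapsto 0$ (resp. of $u^{-1}\mapsto 0$; resp. the intersection of these two kernels). - $Z$ is the set of quadruples $(g_{01}^{00},g_{10}^{00},g_{11}^{01},g_{11}^{10})$ with $g_{01}^{00}\in G[t,u,u^{-1}]$, $g_{10}^{00}\in G[t,t^{-1},u]$, $g_{11}^{01}\in G[t,t^{-1},u^{-1}]_1^u$, $g_{11}^{10}\in G[t^{-1},u,u^{-1}]_1^t$ and $g_{11}^{01}g_{01}^{00}=g_{11}^{10}g_{10}^{00}$ in $G[t,t^{-1},u,u^{-1}]$. - $H=G[t,u]\times G[t,u^{-1}]_1^u\times G[t^{-1},u]_1^t\times G[t^{-1},u^{-1}]_1^{t,u}$ acts on $Z$ (freely) by $(h_{00},h_{01},h_{10},h_{11})\cdot(g_{01}^{00},g_{10}^{00},g_{11}^{01},g_{11}^{10})=(h_{01}g_{01}^{00}h_{00}^{-1},\,h_{10}g_{10}^{00}h_{00}^{-1},\,h_{11}g_{11}^{01}h_{01}^{-1},\,h_{11}g_{11}^{10}h_{10}^{-1})$. The action of $N_{\mathrm{GL}(2)}(\mathbb{G}_m)$ on $Z/H$ is induced by: $\mathrm{diag}(\alpha,\beta)$ substitutes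 $t\mapsto\alpha^{-1}t$, $u\mapsto\beta^{-1}u$ in each of the four components; $\begin{pmatrix}0&1\\1&0\end{pmatrix}$ sends $(g_{01}^{00},g_{10}^{00},g_{11}^{01},g_{11}^{10})$ to $(g_{10}^{00},g_{01}^{00},g_{11}^{10},g_{11}^{01})$ with $t$ and $u$ interchanged. $\mathrm{Bun}_G(\mathbb{A}^2/\mathbb{G}_m)$, the moduli space of $\mathbb{G}_m$-equivariant such pairs, is identified with the fixed-point set $\mathrm{Bun}_G(\mathbb{A}^2)^{\mathbb{G}_m}$. Definition of $\Psi$. If the $H$-orbit of $(g_{01}^{00},g_{10}^{00},g_{11}^{01},g_{11}^{10})\in Z$ is $\mathbb{G}_m$-fixed, then there are unique factorizations $g_{11}^{01}=(g_{11}^{01})'(g_{11}^{01})''$ and $g_{11}^{10}=(g_{11}^{10})'(g_{11}^{10})''$ with $(g_{11}^{01})',(g_{11}^{10})'\in G[t^{-1},u^{-1}]_1^{t,u}$, $(g_{11}^{01})''\in G[t,u^{-1}]_1^u$, $(g_{11}^{10})''\in G[t^{-1},u]_1^t$, and there is a unique $\gamma\in G[t^{-1}]_1$ with $((g_{11}^{01})')^{-1}(g_{11}^{10})'=\gamma|_{t\mapsto tu}$. Then $\Psi$ sends this $H$-orbit to $\gamma$; it is a bijection $\mathrm{Bun}_G(\mathbb{A}^2/\mathbb{G}_m)\to\mathsf{Gr}_0$ and coincides with the Braverman--Finkelberg bijection. *)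

(* Defs.v *)
From HB Require Import structures.
From mathcomp Require Import all_boot all_order all_algebra.
From mathcomp Require Import finmap.
From mathcomp Require Import boolp classical_sets functions cardinality reals.
From mathcomp Require Import complex.
From mathcomp Require Import monalg ring.
From mathcomp Require mpoly.

Set Implicit Arguments.
Unset Strict Implicit.
Unset Printing Implicit Defensive.

Import Order.TTheory GRing.Theory Num.Theory.

Local Open Scope classical_set_scope.
Local Open Scope ring_scope.

(* Laurent polynomials in t and u: finitely supported functions on Z x Z,
   where the exponent (i, j) stands for t ^ i * u ^ j. [monalg] only makes
   {malg R[K]} a ring when no nontrivial element of K is invertible, so the
   convolution product on this group algebra is defined here. *)
Definition laurent (R : comNzRingType) := {malg R[(int * int)%type]}.

HB.instance Definition _ (R : comNzRingType) := GRing.Lmodule.on (laurent R).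

HB.lock Definition lmonom (R : comNzRingType) (c : R) (k : int * int) :
  laurent R := << c *g k >>%R.

HB.lock Definition laurent_mul (R : comNzRingType) (f g : laurent R) :
  laurent R :=
  \sum_(k <- msupp f) \sum_(l <- msupp g) lmonom (f@_k * g@_l) (k + l).

Arguments lmonom {R}.
Arguments laurent_mul {R}.

Section LaurentRing.
Variable R : comNzRingType.
Implicit Types (f g h : laurent R) (k : int * int) (c : R).

Lemma msupp_lmonom c k : (msupp (lmonom c k) `<=` [fset k])%fset.
Proof. by rewrite lmonom.unlock; exact: msuppU_le. Qed.

Lemma mcoeff_lmonom c k l : (lmonom c k)@_l = c *+ (k == l).
Proof. by rewrite lmonom.unlock mcoeffU. Qed.

Lemma lmonom0 k : lmonom 0 k = 0 :> laurent R.
Proof. by rewrite lmonom.unlock monalgU0. Qed.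

Lemma lmonomD k c d : lmonom (c + d) k = lmonom c k + lmonom d k.
Proof. by rewrite lmonom.unlock monalgUD. Qed.

Lemma lmonomB k c d : lmonom (c - d) k = lmonom c k - lmonom d k.
Proof. by rewrite lmonom.unlock monalgUB. Qed.

Lemma laurentE f : f = \sum_(k <- msupp f) lmonom f@_k k.
Proof. by rewrite lmonom.unlock; exact: monalgE. Qed.

Definition laurent_one : laurent R := lmonom 1 0.

Lemma laurent_mulE f g : laurent_mul f g =
  \sum_(k <- msupp f) \sum_(l <- msupp g) lmonom (f@_k * g@_l) (k + l).
Proof. by rewrite laurent_mul.unlock. Qed.

Lemma laurent_mulw (d1 d2 : {fset (int * int)%type}) f g :
  (msupp f `<=` d1)%fset -> (msupp g `<=` d2)%fset ->
  laurent_mul f g =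
    \sum_(k <- d1) \sum_(l <- d2) lmonom (f@_k * g@_l) (k + l).
Proof.
move=> le1 le2; rewrite laurent_mulE (big_fset_incl _ le1) /=.
  apply: eq_bigr => k _; apply: big_fset_incl => // l _ /mcoeff_outdom ->.
  by rewrite mulr0 lmonom0.
move=> k _ /mcoeff_outdom fk.
by rewrite big1 // => l _; rewrite fk mul0r lmonom0.
Qed.

Lemma laurent_mulC : commutative (@laurent_mul R).
Proof.
move=> f g; rewrite !laurent_mulE [LHS]exchange_big /=.
apply: eq_bigr => l _; apply: eq_bigr => k _.
by rewrite mulrC addrC.
Qed.

Lemma laurent_mul0 : left_zero 0 (@laurent_mul R).
Proof. by move=> g; rewrite laurent_mulE msupp0 big_seq_fset0. Qed.

Lemma laurent_mulUU c1 c2 k1 k2 :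
  laurent_mul (lmonom c1 k1) (lmonom c2 k2) = lmonom (c1 * c2) (k1 + k2).
Proof.
by rewrite (laurent_mulw (msupp_lmonom _ _) (msupp_lmonom _ _))
  !big_seq_fset1 !mcoeff_lmonom !eqxx.
Qed.

Lemma laurent_mulDl : left_distributive (@laurent_mul R) +%R.
Proof.
move=> f1 f2 g.
rewrite [in RHS](laurent_mulw (fsubsetUl _ (msupp f2)) (fsubset_refl _)).
rewrite [in RHS](laurent_mulw (fsubsetUr (msupp f1) _) (fsubset_refl _)).
rewrite (laurent_mulw (msuppD_le _ _) (fsubset_refl _)) -big_split /=.
apply: eq_bigr => k _; rewrite -big_split /=; apply: eq_bigr => l _.
by rewrite mcoeffD mulrDl lmonomD.
Qed.

Lemma laurent_mulDr : right_distributive (@laurent_mul R) +%R.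
Proof.
by move=> f g1 g2; rewrite !(laurent_mulC f) laurent_mulDl.
Qed.

Lemma laurent_mul1 : left_id laurent_one (@laurent_mul R).
Proof.
move=> g; rewrite /laurent_one.
rewrite (laurent_mulw (msupp_lmonom _ _) (fsubset_refl _)) big_seq_fset1.
rewrite [RHS]laurentE.
by apply: eq_bigr => k _; rewrite mcoeff_lmonom eqxx mul1r add0r.
Qed.

Lemma laurent_mul_suml I (r : seq I) (F : I -> laurent R) g :
  laurent_mul (\sum_(i <- r) F i) g = \sum_(i <- r) laurent_mul (F i) g.
Proof.
exact: (big_morph (laurent_mul^~ g) (fun _ _ => laurent_mulDl _ _ _)
         (laurent_mul0 _)).
Qed.

Lemma laurent_mul_sumr I (r : seq I) (F : I -> laurent R) g :
  laurent_mul g (\sum_(i <- r) F i) = \sum_(i <- r) laurent_mul g (F i).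
Proof.
rewrite laurent_mulC laurent_mul_suml.
by apply: eq_bigr => i _; rewrite laurent_mulC.
Qed.

Lemma laurent_sum f :
  exists r : seq (R * (int * int)), f = \sum_(x <- r) lmonom x.1 x.2.
Proof.
exists [seq (f@_k, k) | k <- msupp f].
by rewrite big_map; exact: laurentE.
Qed.

Lemma laurent_mulA : associative (@laurent_mul R).
Proof.
move=> f g h.
have [rf ->] := laurent_sum f; have [rg ->] := laurent_sum g.
have [rh ->] := laurent_sum h.
rewrite !laurent_mul_suml; apply: eq_bigr => x _.
rewrite [LHS]laurent_mul_sumr.
rewrite [X in _ = laurent_mul X _]laurent_mul_sumr [RHS]laurent_mul_suml.
apply: eq_bigr => y _.
rewrite !laurent_mul_sumr; apply: eq_bigr => z _.
by rewrite !laurent_mulUU mulrA addrA.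
Qed.

Lemma laurent_one_neq0 : laurent_one != 0.
Proof.
apply/eqP => /(congr1 (mcoeff 0)) /eqP.
by rewrite mcoeff_lmonom mcoeff0 oner_eq0.
Qed.

HB.instance Definition _ := GRing.Zmodule_isComNzRing.Build (laurent R)
  laurent_mulA laurent_mulC laurent_mul1 laurent_mulDl laurent_one_neq0.

Definition laurent_unit : {pred laurent R} :=
  fun f => `[< exists g, g * f = 1 >].

Definition laurent_inv f : laurent R :=
  if pselect (exists g, g * f = 1) is left h then projT1 (cid h) else f.

Lemma laurent_mulVr : {in laurent_unit, left_inverse 1 laurent_inv *%R}.
Proof.
move=> f; rewrite unfold_in => /asboolP hf; rewrite /laurent_inv.
by case: pselect => // h; case: cid.
Qed.

Lemma laurent_unitP f g : g * f = 1 -> laurent_unit f.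
Proof. by move=> gf; apply/asboolP; exists g. Qed.

Lemma laurent_inv_out : {in [predC laurent_unit], laurent_inv =1 id}.
Proof.
move=> f; rewrite inE /laurent_inv unfold_in => /asboolP hf.
by case: pselect.
Qed.

HB.instance Definition _ := GRing.ComNzRing_hasMulInverse.Build (laurent R)
  laurent_mulVr laurent_unitP laurent_inv_out.

End LaurentRing.

Definition laurentC (R : comNzRingType) (c : R) : laurent R := lmonom c 0.

(* The substitution t |-> X, u |-> Y, for units X and Y. *)
HB.lock Definition lsubst (R : comNzRingType) (X Y f : laurent R) : laurent R :=
  \sum_(k <- msupp f) laurentC f@_k * X ^ k.1 * Y ^ k.2.

Arguments lsubst {R}.

Section LaurentSubst.
Variable R : comNzRingType.
Implicit Types (f X Y : laurent R) (k l : int * int) (c d : R).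

(* The variables t and u. *)
Definition lvt : laurent R := lmonom 1 (1, 0).
Definition lvu : laurent R := lmonom 1 (0, 1).

Lemma lmonomM c d k l : lmonom c k * lmonom d l = lmonom (c * d) (k + l).
Proof. exact: laurent_mulUU. Qed.

HB.instance Definition _ := GRing.isZmodMorphism.Build R (laurent R)
  (@laurentC R) (lmonomB 0).

Lemma laurentC_is_monoid_morphism : monoid_morphism (@laurentC R).
Proof. by split=> // c d; rewrite /laurentC lmonomM addr0. Qed.

HB.instance Definition _ := GRing.isMonoidMorphism.Build R (laurent R)
  (@laurentC R) laurentC_is_monoid_morphism.

Lemma lsubst_mmap X Y f :
  lsubst X Y f = mmap (@laurentC R) (fun k => X ^ k.1 * Y ^ k.2) f.
Proof.
by rewrite lsubst.unlock; apply: eq_bigr => k _; rewrite mulrA.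
Qed.

Lemma lsubst_lmonom X Y c k :
  lsubst X Y (lmonom c k) = laurentC c * X ^ k.1 * Y ^ k.2.
Proof.
rewrite lsubst_mmap (mmapEw (msupp_lmonom _ _)) big_seq_fset1.
by rewrite mcoeff_lmonom eqxx mulrA.
Qed.

(* The specializations t^-1 |-> 0 and u^-1 |-> 0, meaningful on Laurent
   polynomials without positive powers of t, resp. of u. *)
Definition tinv0 f : laurent R := \sum_(k <- msupp f | k.1 == 0) lmonom f@_k k.
Definition uinv0 f : laurent R := \sum_(k <- msupp f | k.2 == 0) lmonom f@_k k.

End LaurentSubst.

Arguments lvt {R}.
Arguments lvu {R}.

Section LaurentField.
Variable F : fieldType.
Implicit Types (f : laurent F) (k l : int * int) (a b c d : F).

Lemma lsubst_sum X Y I (r : seq I) (f : I -> laurent F) :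
  lsubst X Y (\sum_(i <- r) f i) = \sum_(i <- r) lsubst X Y (f i).
Proof.
rewrite lsubst_mmap raddf_sum.
by apply: eq_bigr => i _; rewrite lsubst_mmap.
Qed.

Lemma lmonomXz c k (i : int) :
  c != 0 -> lmonom c k ^ i = lmonom (c ^ i) (k *~ i).
Proof.
move=> c0; have pos m : lmonom c k ^+ m = lmonom (c ^+ m) (k *+ m).
  by elim: m => // m IH; rewrite !exprS IH lmonomM mulrS.
case: i => m; first exact: pos.
rewrite NegzE -exprnN pos mulrNz -exprnN.
apply: (@mulrI _ (lmonom (c ^+ m.+1) (k *+ m.+1))).
  apply/unitrP; exists (lmonom (c ^- m.+1) (- (k *+ m.+1))).
  by rewrite !lmonomM mulVf ?mulfV ?expf_neq0 // addNr addrN.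
rewrite lmonomM mulfV ?expf_neq0 // addrN mulrV //.
apply/unitrP; exists (lmonom (c ^- m.+1) (- (k *+ m.+1))).
by rewrite !lmonomM mulVf ?mulfV ?expf_neq0 // addNr addrN.
Qed.

Lemma lsubst_lmonomE c d k l e m : c != 0 -> d != 0 ->
  lsubst (lmonom c k) (lmonom d l) (lmonom e m) =
    lmonom (e * c ^ m.1 * d ^ m.2) (k *~ m.1 + l *~ m.2).
Proof.
by move=> c0 d0; rewrite lsubst_lmonom !lmonomXz // !lmonomM add0r.
Qed.

Lemma pair_mulrz k (i : int) : k *~ i = (k.1 * i, k.2 * i).
Proof.
have e (m : nat) : k *+ m = (k.1 *+ m, k.2 *+ m).
  by elim: m => // m IH; rewrite !mulrS IH.
have ez (x : int) (m : nat) : x *+ m = x * m by rewrite -mulr_natr natz.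
case: i => m; first by rewrite -pmulrn e !ez.
by rewrite NegzE mulrNz -pmulrn e !ez !mulrN.
Qed.

Lemma lsubst_comp c d k l c' d' k' l' f :
  c != 0 -> d != 0 -> c' != 0 -> d' != 0 ->
  lsubst (lmonom c k) (lmonom d l) (lsubst (lmonom c' k') (lmonom d' l') f) =
  lsubst (lsubst (lmonom c k) (lmonom d l) (lmonom c' k'))
         (lsubst (lmonom c k) (lmonom d l) (lmonom d' l')) f.
Proof.
move=> c0 d0 c'0 d'0; have [r ->] := laurent_sum f.
rewrite !lsubst_sum; apply: eq_bigr => -[e m] _ /=.
rewrite !lsubst_lmonomE ?mulf_neq0 ?expfz_neq0 //.
congr lmonom.
  rewrite !pair_mulrz /= !expfzDr // !expfzMl !exprz_exp.
  ring.
rewrite !pair_mulrz; congr pair => /=; ring.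
Qed.

Lemma lsubst_id f : lsubst (lmonom 1 (1, 0)) (lmonom 1 (0, 1)) f = f.
Proof.
have [r ->] := laurent_sum f; rewrite lsubst_sum; apply: eq_bigr => -[e m] _.
rewrite lsubst_lmonomE ?oner_eq0 //= !exp1rz !mulr1 !pair_mulrz.
by case: m => i j; congr lmonom; congr pair => /=; ring.
Qed.

Lemma scale_lvt a : laurentC a * lvt = lmonom a (1, 0).
Proof. by rewrite /lvt lmonomM mulr1 add0r. Qed.

Lemma scale_lvu a : laurentC a * lvu = lmonom a (0, 1).
Proof. by rewrite /lvu lmonomM mulr1 add0r. Qed.

Lemma lsubst_diagM a b c d f : a != 0 -> b != 0 -> c != 0 -> d != 0 ->
  lsubst (laurentC a * lvt) (laurentC b * lvu)
    (lsubst (laurentC c * lvt) (laurentC d * lvu) f) =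
  lsubst (laurentC (a * c) * lvt) (laurentC (b * d) * lvu) f.
Proof.
move=> a0 b0 c0 d0; rewrite !scale_lvt !scale_lvu lsubst_comp //.
rewrite !lsubst_lmonomE //= !pair_mulrz.
by congr (lsubst (lmonom _ _) (lmonom _ _) f) => /=;
  rewrite ?expr1z ?expr0z; ring.
Qed.

Lemma lsubst_swapK f : lsubst lvu lvt (lsubst lvu lvt f) = f.
Proof.
rewrite /lvt /lvu lsubst_comp ?oner_neq0 // !lsubst_lmonomE ?oner_neq0 //=.
by rewrite !exp1rz !mulr1 !pair_mulrz lsubst_id.
Qed.

Lemma lsubst_swap_diag a b f : a != 0 -> b != 0 ->
  lsubst lvu lvt (lsubst (laurentC a * lvt) (laurentC b * lvu) f) =
  lsubst (laurentC b * lvt) (laurentC a * lvu) (lsubst lvu lvt f).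
Proof.
move=> a0 b0; rewrite !scale_lvt !scale_lvu /lvt /lvu.
rewrite !lsubst_comp ?oner_neq0 //.
rewrite !lsubst_lmonomE ?oner_neq0 //= !pair_mulrz.
by congr (lsubst (lmonom _ _) (lmonom _ _) f) => /=;
  rewrite ?exp1rz ?expr1z ?expr0z; ring.
Qed.

End LaurentField.

(* [lring I J] is the set of Laurent polynomials whose exponents of t lie in I
   and whose exponents of u lie in J. *)
Definition lring (R : comNzRingType) (I J : pred int) : set (laurent R) :=
  [set f | forall k, f@_k != 0 -> I k.1 /\ J k.2].

Definition epos : pred int := fun i => 0 <= i.
Definition eneg : pred int := fun i => i <= 0.
Definition eany : pred int := predT.
Definition enul : pred int := pred1 0.

(* Linear algebraic groups over an algebraically closed field F are Zariski
   closed subgroups of GL_n(F), given by their sets of F-points. *)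
Section AlgebraicGroups.
Variable F : closedFieldType.

(* Value of a polynomial in the matrix entries, with the coefficients mapped
   by iota. *)
Definition mxeval (A : comNzRingType) (iota : F -> A) (n : nat)
    (p : mpoly.mpoly (n * n) F) (M : 'M[A]_n) : A :=
  mpoly.mmap iota (fun k => mxvec M 0 k) p.

Definition zclosed (n : nat) (X : set 'M[F]_n) : Prop :=
  exists S : set (mpoly.mpoly (n * n) F),
    forall M, X M <-> M \in unitmx /\ forall p, S p -> mxeval idfun p M = 0.

Definition mxsubgroup (n : nat) (K : set 'M[F]_n) : Prop :=
  [/\ K `<=` [set M | M \in unitmx],
      K 1%:M,
      forall M N, K M -> K N -> K (M *m N) &
      forall M, K M -> K (invmx M)].

Definition alggroup (n : nat) (G : set 'M[F]_n) : Prop :=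
  mxsubgroup G /\ zclosed G.

Definition zconnected (n : nat) (X : set 'M[F]_n) : Prop :=
  forall A B : set 'M[F]_n, zclosed A -> zclosed B ->
    X = A `|` B -> A `&` B = set0 -> A = set0 \/ B = set0.

Definition normal_in (n : nat) (G N : set 'M[F]_n) : Prop :=
  N `<=` G /\ forall g x, G g -> N x -> N (g *m x *m invmx g).

Definition derived (n : nat) (K : set 'M[F]_n) : set 'M[F]_n :=
  [set M | forall L, mxsubgroup L ->
    (forall x y, K x -> K y -> L (x *m y *m invmx x *m invmx y)) -> L M].

Definition solvable_group (n : nat) (K : set 'M[F]_n) : Prop :=
  exists k : nat, iter k (@derived n) K `<=` [set 1%:M].

Definition semisimple (n : nat) (G : set 'M[F]_n) : Prop :=
  [/\ alggroup G, zconnected G &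
      forall N, alggroup N -> zconnected N -> normal_in G N ->
        solvable_group N -> N = [set 1%:M]].

(* On GL_m a regular function is a polynomial in the entries divided by a power
   of the determinant, and regular functions on a closed subset extend. *)
Definition regular_on (m n : nat) (H : set 'M[F]_m)
    (f : 'M[F]_m -> 'M[F]_n) : Prop :=
  exists (k : nat) (P : 'I_n -> 'I_n -> mpoly.mpoly (m * m) F),
    forall M, H M ->
      forall i j, f M i j = mxeval idfun (P i j) M / (\det M) ^+ k.

Definition alghom (m n : nat) (H : set 'M[F]_m) (G : set 'M[F]_n)
    (f : 'M[F]_m -> 'M[F]_n) : Prop :=
  [/\ set_fun H G f, regular_on H f &
      forall M N, H M -> H N -> f (M *m N) = f M *m f N].

Definition isogeny (m n : nat) (H : set 'M[F]_m) (G : set 'M[F]_n)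
    (f : 'M[F]_m -> 'M[F]_n) : Prop :=
  [/\ alghom H G f, set_surj H G f & finite_set (H `&` f @^-1` [set 1%:M])].

Definition algiso (m n : nat) (H : set 'M[F]_m) (G : set 'M[F]_n)
    (f : 'M[F]_m -> 'M[F]_n) : Prop :=
  alghom H G f /\
  exists f' : 'M[F]_n -> 'M[F]_m,
    [/\ alghom G H f', {in H, cancel f f'} & {in G, cancel f' f}].

(* In characteristic 0 an isogeny from a connected group is automatically
   central, so no separability or centrality condition is needed. *)
Definition simply_connected (n : nat) (G : set 'M[F]_n) : Prop :=
  forall (m : nat) (H : set 'M[F]_m) (f : 'M[F]_m -> 'M[F]_n),
    alggroup H -> zconnected H -> isogeny H G f -> algiso H G f.

(* G(S) for a subring S of the Laurent polynomial ring: the matrices over S,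
   invertible over S, at which the whole vanishing ideal of G vanishes. *)
Definition points (n : nat) (G : set 'M[F]_n) (S : set (laurent F)) :
    set 'M[laurent F]_n :=
  [set g | [/\ g \in unitmx,
     forall i j, S (g i j),
     forall i j, S (invmx g i j) &
     forall p : mpoly.mpoly (n * n) F,
       (forall M, G M -> mxeval idfun p M = 0) ->
       mxeval (@laurentC F) p g = 0]].

End AlgebraicGroups.

Section BunGA2.
Variables (F : closedFieldType) (n : nat) (G : set 'M[F]_n).

Local Notation L := (laurent F).
Local Notation GL I J := (points G (@lring F I J)).

Definition ker_t : set 'M[L]_n := [set g | map_mx (@tinv0 F) g = 1%:M].
Definition ker_u : set 'M[L]_n := [set g | map_mx (@uinv0 F) g = 1%:M].

(* The fields g01_00, g10_00, g11_01, g11_10 are the transition functions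
   written with subscript 01 and superscript 00, etc. *)
Record quad := Quad {
  g01_00 : 'M[L]_n;
  g10_00 : 'M[L]_n;
  g11_01 : 'M[L]_n;
  g11_10 : 'M[L]_n }.

Record gauge := Gauge {
  h00 : 'M[L]_n;
  h01 : 'M[L]_n;
  h10 : 'M[L]_n;
  h11 : 'M[L]_n }.

Definition Zset : set quad :=
  [set z | [/\ GL epos eany (g01_00 z),
               GL eany epos (g10_00 z),
               (GL eany eneg `&` ker_u) (g11_01 z),
               (GL eneg eany `&` ker_t) (g11_10 z) &
               g11_01 z *m g01_00 z = g11_10 z *m g10_00 z]].

Definition Hset : set gauge :=
  [set h | [/\ GL epos epos (h00 h),
               (GL epos eneg `&` ker_u) (h01 h),
               (GL eneg epos `&` ker_t) (h10 h) &
               (GL eneg eneg `&` (ker_t `&` ker_u)) (h11 h)]].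

Definition Hact (h : gauge) (z : quad) : quad :=
  Quad (h01 h *m g01_00 z *m invmx (h00 h))
       (h10 h *m g10_00 z *m invmx (h00 h))
       (h11 h *m g11_01 z *m invmx (h01 h))
       (h11 h *m g11_10 z *m invmx (h10 h)).

Definition Horbit (z : quad) : set quad := [set Hact h z | h in Hset].

Definition BunA2 : set (set quad) := [set Horbit z | z in Zset].

Definition msubst (X Y : L) (g : 'M[L]_n) : 'M[L]_n := map_mx (lsubst X Y) g.

Definition diag_act (a b : F) (z : quad) : quad :=
  let s := msubst (laurentC a^-1 * lvt) (laurentC b^-1 * lvu) in
  Quad (s (g01_00 z)) (s (g10_00 z)) (s (g11_01 z)) (s (g11_10 z)).

Definition swap_act (z : quad) : quad :=
  let s := msubst lvu lvt in
  Quad (s (g10_00 z)) (s (g01_00 z)) (s (g11_10 z)) (s (g11_01 z)).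

Definition mx2 (a b c d : F) : 'M[F]_2 :=
  \matrix_(i, j) if i == 0 then if j == 0 then a else b
                 else if j == 0 then c else d.

(* The subgroup of GL(2) generated by the invertible diagonal matrices and
   mx2 0 1 1 0. *)
Definition NGm : set 'M[F]_2 :=
  [set M | exists a b : F, [/\ a != 0, b != 0 &
             M = mx2 a 0 0 b \/ M = mx2 0 a b 0]].

(* Action of NGm on quadruples, from
   mx2 0 a b 0 = mx2 a 0 0 b *m mx2 0 1 1 0. *)
Definition N_act (M : 'M[F]_2) (z : quad) : quad :=
  if M 0 1 == 0 then diag_act (M 0 0) (M 1 1) z
  else diag_act (M 0 1) (M 1 0) (swap_act z).

Lemma mx2M a b c d a' b' c' d' :
  mx2 a b c d *m mx2 a' b' c' d' =
  mx2 (a * a' + b * c') (a * b' + b * d') (c * a' + d * c') (c * b' + d * d').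
Proof.
apply/matrixP => i j; rewrite !mxE !big_ord_recl big_ord0 !mxE /= addr0.
by case: (i == 0); case: (j == 0).
Qed.

Lemma N_act_diag a b : N_act (mx2 a 0 0 b) =1 diag_act a b.
Proof. by move=> z; rewrite /N_act !mxE /= eqxx. Qed.

Lemma N_act_antidiag a b : a != 0 ->
  N_act (mx2 0 a b 0) =1 diag_act a b \o swap_act.
Proof. by move=> a0 z; rewrite /N_act !mxE /= (negPf a0). Qed.

Lemma diag_actM a b c d z : a != 0 -> b != 0 -> c != 0 -> d != 0 ->
  diag_act a b (diag_act c d z) = diag_act (a * c) (b * d) z.
Proof.
move=> a0 b0 c0 d0; have H g :
    msubst (laurentC a^-1 * lvt) (laurentC b^-1 * lvu)
    (msubst (laurentC c^-1 * lvt) (laurentC d^-1 * lvu) g) =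
    msubst (laurentC (a * c)^-1 * lvt) (laurentC (b * d)^-1 * lvu) g.
  rewrite (invfM a c) (invfM b d); apply/matrixP => i j.
  by rewrite !mxE lsubst_diagM ?invr_eq0.
by rewrite /diag_act /= !H.
Qed.

Lemma swap_actK : involutive swap_act.
Proof.
have H g : msubst lvu lvt (msubst lvu lvt g) = g.
  by apply/matrixP => i j; rewrite !mxE lsubst_swapK.
by case=> *; rewrite /swap_act /= !H.
Qed.

Lemma swap_diag_act a b z : a != 0 -> b != 0 ->
  swap_act (diag_act a b z) = diag_act b a (swap_act z).
Proof.
move=> a0 b0; have H g :
    msubst lvu lvt (msubst (laurentC a^-1 * lvt) (laurentC b^-1 * lvu) g) =
    msubst (laurentC b^-1 * lvt) (laurentC a^-1 * lvu) (msubst lvu lvt g).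
  by apply/matrixP => i j; rewrite !mxE lsubst_swap_diag ?invr_eq0.
by rewrite /swap_act /diag_act /= !H.
Qed.

Lemma N_act1 z : N_act 1%:M z = z.
Proof.
have H g : msubst (laurentC 1^-1 * lvt) (laurentC 1^-1 * lvu) g = g.
  by apply/matrixP => i j; rewrite !mxE invr1 scale_lvt scale_lvu lsubst_id.
by rewrite /N_act !mxE /= eqxx /diag_act !H; case: z.
Qed.

Lemma N_actM M M' z :
  NGm M -> NGm M' -> N_act (M *m M') z = N_act M (N_act M' z).
Proof.
move=> [a [b [a0 b0 HM]]] [c [d [c0 d0 HM']]].
case: HM => ->; case: HM' => ->; rewrite mx2M !(mulr0, mul0r, addr0, add0r).
- by rewrite !N_act_diag diag_actM.
- by rewrite N_act_diag !N_act_antidiag ?mulf_neq0 //= diag_actM.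
- rewrite N_act_diag !N_act_antidiag ?mulf_neq0 //=.
  by rewrite swap_diag_act // diag_actM.
- rewrite N_act_diag !N_act_antidiag //=.
  by rewrite swap_diag_act // swap_actK diag_actM.
Qed.

Definition N_orb (M : 'M[F]_2) (O : set quad) : set quad := N_act M @` O.

Definition BunA2Gm : set (set quad) :=
  [set O | BunA2 O /\ forall z : F, z != 0 -> N_orb (mx2 z 0 0 z^-1) O = O].

(* G[t^-1]_1, identified with the open subset Gr_0 of the affine Grassmannian
   by g |-> g G[t]. *)
Definition Gr0 : set 'M[L]_n := GL eneg enul `&` ker_t.

Definition factors (z : quad) (gamma : 'M[L]_n) : Prop :=
  exists a a' b b' : 'M[L]_n,
    [/\ (GL eneg eneg `&` (ker_t `&` ker_u)) a,
        (GL epos eneg `&` ker_u) a' & g11_01 z = a *m a'] /\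
    [/\ (GL eneg eneg `&` (ker_t `&` ker_u)) b,
        (GL eneg epos `&` ker_t) b' & g11_10 z = b *m b'] /\
    invmx a *m b = msubst (lvt * lvu) lvu gamma.

(* The Braverman-Finkelberg bijection is defined by its value on the orbit of
   any representative; set_bij records that it is a bijection. *)
Definition BF_bijection (Psi : set quad -> 'M[L]_n) : Prop :=
  set_bij BunA2Gm Gr0 Psi /\
  forall z, Zset z -> BunA2Gm (Horbit z) -> factors z (Psi (Horbit z)).

(* The inverse Gr0 -> BunA2Gm of a bijection Psi, and the action on Gr0
   transported along Psi. *)
Definition BF_inverse (Psi : set quad -> 'M[L]_n) (gamma : 'M[L]_n) :
    set quad :=
  xget set0 (BunA2Gm `&` Psi @^-1` [set gamma]).

Definition transported (Psi : set quad -> 'M[L]_n) (M : 'M[F]_2)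
    (gamma : 'M[L]_n) : 'M[L]_n :=
  Psi (N_orb M (BF_inverse Psi gamma)).

(* g(t^-1) |-> g(c t^-1), i.e. t |-> c^-1 t. *)
Definition rescale (c : F) (g : 'M[L]_n) : 'M[L]_n :=
  msubst (laurentC c^-1 * lvt) lvu g.

Definition Gr_iota (g : 'M[L]_n) : 'M[L]_n := invmx (rescale (-1) g).

End BunGA2.

(* Main.v *)
(** Write Psi O = a^-1 b |_{tu -> t}, where a and b are the left Birkhoff factors
    of g11_01 and g11_10. A monomial substitution in t, u commuting with the
    gauge action carries these factorizations to factorizations: the diagonal
    matrices keep the pair (a, b) and rescale tu by (alpha beta)^-1, while the
    swap exchanges a and b and fixes tu, hence inverts a^-1 b. Uniqueness of
    Birkhoff factorizations then identifies the value of Psi at the transformed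
    orbit. *)

Require Import Defs.
From HB Require Import structures.
From mathcomp Require Import all_boot all_order all_algebra.
From mathcomp Require Import finmap monalg ring.
From mathcomp Require mpoly.
From mathcomp Require Import boolp classical_sets functions reals complex.

Import Order.TTheory GRing.Theory Num.Theory.

Local Open Scope classical_set_scope.
Local Open Scope ring_scope.

Set Implicit Arguments.
Unset Strict Implicit.
Unset Printing Implicit Defensive.

(** * Coefficients, exponent restrictions and supports of Laurent polynomials *)

Section Laurent.
Variable R : comNzRingType.
Implicit Types (f g x : laurent R) (P : pred (int * int)) (I J : pred int).

Lemma mcoeffM_laurent (d1 d2 : {fset (int * int)%type}) f g m :
  (msupp f `<=` d1)%fset -> (msupp g `<=` d2)%fset ->
  (f * g)@_m =
    \sum_(k <- d1) \sum_(l <- d2) (f@_k * g@_l) *+ (k + l == m).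
Proof.
move=> le1 le2.
rewrite -[f * g]/(laurent_mul f g) (laurent_mulw le1 le2).
rewrite raddf_sum; apply: eq_bigr => k _.
by rewrite raddf_sum; apply: eq_bigr => l _; exact: mcoeff_lmonom.
Qed.

(* [tinv0] and [uinv0] are the cases [P k := k.1 == 0] and [P k := k.2 == 0]. *)
Definition lrestr P f : laurent R := \sum_(k <- msupp f | P k) lmonom f@_k k.

Lemma mcoeff_lrestr P f k : (lrestr P f)@_k = f@_k *+ P k.
Proof.
rewrite /lrestr raddf_sum /= (eq_bigr (fun l => f@_l *+ (l == k))); last first.
  by move=> l _; exact: mcoeff_lmonom.
have [kf|/mcoeff_outdom f0] := boolP (k \in msupp f); last first.
  rewrite f0 mul0rn big1 // => l _.
  by have [->|//] := eqVneq l k; rewrite f0.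
rewrite big_mkcond (bigD1_seq k) ?fset_uniq //= eqxx big1 ?addr0 => [|l].
  by case: (P k).
by move=> /negPf->; case: (P l).
Qed.

(** Multiplying by [x] shifts exponents by elements of its support; when no such shift crosses the
    boundary of [P], restriction to [P] is linear over [x]. *)
Lemma lrestrM P f x :
  (forall k l, x@_l != 0 -> P (k + l) = P k) ->
  lrestr P (f * x) = lrestr P f * x.
Proof.
move=> Px; apply/malgP => m; rewrite mcoeff_lrestr.
have le : (msupp (lrestr P f) `<=` msupp f)%fset.
  apply/fsubsetP => k; rewrite -!mcoeff_neq0 mcoeff_lrestr.
  by apply: contraNN => /eqP->; rewrite mul0rn.
rewrite (mcoeffM_laurent _ le (fsubset_refl _)).
rewrite (mcoeffM_laurent _ (fsubset_refl _) (fsubset_refl _)).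
rewrite -sumrMnl; apply: eq_bigr => k _.
rewrite -sumrMnl; apply: eq_bigr => l _.
rewrite mcoeff_lrestr; have [->|x0] := eqVneq x@_l 0.
  by rewrite !mulr0 !mul0rn.
have [<-|] := eqVneq; last by rewrite !mulr0n mul0rn.
by rewrite Px // !mulr1n mulrnAl.
Qed.

Lemma lrestr_mulmx P n (A B : 'M[laurent R]_n) :
  (forall i j k l, (B i j)@_l != 0 -> P (k + l) = P k) ->
  map_mx (lrestr P) (A *m B) = map_mx (lrestr P) A *m B.
Proof.
move=> PB; apply/matrixP => i j; rewrite !mxE.
have lrestr_sum (f : 'I_n -> laurent R) :
    lrestr P (\sum_k f k) = \sum_k lrestr P (f k).
  apply/malgP => k; rewrite mcoeff_lrestr !raddf_sum -sumrMnl.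
  by apply: eq_bigr => l _; exact/esym/mcoeff_lrestr.
rewrite lrestr_sum; apply: eq_bigr => k _.
by rewrite mxE lrestrM // => ? ?; exact: PB.
Qed.

Definition addclosed I := forall i j, I i -> I j -> I (i + j).

Lemma addclosed_epos : addclosed epos. Proof. exact: addr_ge0. Qed.
Lemma addclosed_eneg : addclosed eneg.
Proof. by move=> i j i0 j0; rewrite /eneg -(addr0 0) lerD. Qed.

Lemma lringM I J f g : addclosed I -> addclosed J ->
  lring I J f -> lring I J g -> lring I J (f * g).
Proof.
move=> addI addJ If Ig m.
rewrite (mcoeffM_laurent _ (fsubset_refl _) (fsubset_refl _)).
move=> fgm; apply: contrapT => nIJ; case/eqP: fgm.
rewrite big1 // => k _; rewrite big1 // => l _.
have [->|f0] := eqVneq f@_k 0; first by rewrite mul0r mul0rn.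
have [->|g0] := eqVneq g@_l 0; first by rewrite mulr0 mul0rn.
have [klm|//] := eqVneq; case: nIJ; rewrite -klm.
have [? ?] := If k f0; have [? ?] := Ig l g0.
by split; [exact: addI | exact: addJ].
Qed.

Lemma lring_sum I J n (f : 'I_n -> laurent R) :
  (forall i, lring I J (f i)) -> lring I J (\sum_i f i).
Proof.
move=> If; apply: (big_ind (lring I J)) => // [k|a b Ia Ib k].
  by rewrite mcoeff0 eqxx.
rewrite mcoeffD; have [->|a0 _] := eqVneq a@_k 0; last exact: Ia.
by rewrite add0r; exact: Ib.
Qed.

Lemma lring_mulmx I J n (A B : 'M[laurent R]_n) :
  addclosed I -> addclosed J ->
  (forall i j, lring I J (A i j)) -> (forall i j, lring I J (B i j)) ->
  forall i j, lring I J ((A *m B) i j).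
Proof.
move=> addI addJ IA IB i j; rewrite mxE; apply: lring_sum => k.
exact: lringM.
Qed.

End Laurent.

(** * Monomial substitutions *)

Section Substitution.
Variable F : fieldType.
Implicit Types (f X Y : laurent F) (c d : F) (k l m : int * int).

Lemma lmonom_unit c k : c != 0 -> (lmonom c k : laurent F) \is a GRing.unit.
Proof.
move=> c0; apply/unitrP; exists (lmonom c^-1 (- k)).
by rewrite !lmonomM mulVf ?mulfV // addNr addrN.
Qed.

(** Multiplicativity rests on X^(i+j) = X^i X^j for integers of either sign, which holds for units
    only. The morphism structure is therefore produced under these hypotheses, as an existential to
    rewrite with, rather than as a canonical instance. *)
Lemma lsubst_rmorph X Y : X \is a GRing.unit -> Y \is a GRing.unit ->
  exists s : {rmorphism laurent F -> laurent F}, lsubst X Y = s.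
Proof.
move=> uX uY.
have sB : zmod_morphism (lsubst X Y).
  by move=> f g; rewrite !lsubst_mmap raddfB.
have sM : monoid_morphism (lsubst X Y).
  split=> [|f g].
    by rewrite lsubst_lmonom !expr0z !mulr1.
  have [rf ->] := laurent_sum f; have [rg ->] := laurent_sum g.
  rewrite mulr_suml !lsubst_sum mulr_suml; apply: eq_bigr => x _.
  rewrite mulr_sumr !lsubst_sum mulr_sumr; apply: eq_bigr => y _.
  rewrite lmonomM !lsubst_lmonom !exprzDr // rmorphM /=; ring.
pose s1 := GRing.isZmodMorphism.Build _ _ (lsubst X Y) sB.
pose s2 := GRing.isMonoidMorphism.Build _ _ (lsubst X Y) sM.
pose s : {rmorphism laurent F -> laurent F} := HB.pack (lsubst X Y) s1 s2.
by exists s.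
Qed.

Lemma mcoeff_lsubst_diag c d f k : c != 0 -> d != 0 ->
  (lsubst (laurentC c * lvt) (laurentC d * lvu) f)@_k =
    f@_k * c ^ k.1 * d ^ k.2.
Proof.
move=> c0 d0; have [r ->] := laurent_sum f.
rewrite lsubst_sum !raddf_sum !mulr_suml; apply: eq_bigr => -[e m] _ /=.
rewrite scale_lvt scale_lvu lsubst_lmonomE // !mcoeff_lmonom !pair_mulrz /=.
have -> : (1 * m.1, 0 * m.1) + (0 * m.2, 1 * m.2) = m :> (int * int)%type.
  by case: m => i j; congr pair => /=; ring.
by have [->|] := eqVneq m k; rewrite ?mulr1n // !mulr0n !mul0r.
Qed.

Lemma mcoeff_lsubst_swap f k : (lsubst lvu lvt f)@_k = f@_(k.2, k.1).
Proof.
have [r ->] := laurent_sum f.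
rewrite lsubst_sum !raddf_sum; apply: eq_bigr => -[e m] _ /=.
rewrite /lvt /lvu lsubst_lmonomE ?oner_eq0 // !mcoeff_lmonom !pair_mulrz /=.
rewrite !exp1rz !mulr1; congr (_ *+ nat_of_bool _).
rewrite !mul0r !mul1r; case: m k => i j [i' j'].
by rewrite -[_ + _]/(0 + j, i + 0) add0r addr0 !xpair_eqE andbC.
Qed.

End Substitution.

(** * Substitutions on matrices and on points of G *)

Section Matrices.
Variables (F : closedFieldType) (n : nat) (G : set 'M[F]_n).
Local Notation L := (laurent F).
Implicit Types (A B : 'M[L]_n) (S : set L) (X Y : L) (a b c d : F).
Implicit Types (I J : pred int) (M : 'M[F]_2) (z : quad F n).
Local Notation GL I J := (points G (@lring F I J)).

Lemma invmx_uniq A B : A *m B = 1%:M -> invmx A = B.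
Proof.
move=> AB; have [uA _] := mulmx1_unit AB.
by rewrite -[LHS]mulmx1 -AB mulmxA mulVmx // mul1mx.
Qed.

Lemma invmx_mul A B : A \in unitmx -> B \in unitmx ->
  invmx (A *m B) = invmx B *m invmx A.
Proof.
move=> uA uB; apply: invmx_uniq.
by rewrite mulmxA -(mulmxA A) mulmxV // mulmx1 mulmxV.
Qed.

Section Msubst.
Variables X Y : L.
Hypotheses (uX : X \is a GRing.unit) (uY : Y \is a GRing.unit).

Lemma msubstM A B : msubst X Y (A *m B) = msubst X Y A *m msubst X Y B.
Proof.
by have [s e] := lsubst_rmorph uX uY; rewrite /msubst e map_mxM.
Qed.

Lemma msubst1 : msubst X Y 1%:M = 1%:M :> 'M[L]_n.
Proof.
by have [s e] := lsubst_rmorph uX uY; rewrite /msubst e map_mx1.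
Qed.

Lemma msubstV A : A \in unitmx -> msubst X Y (invmx A) = invmx (msubst X Y A).
Proof.
by move=> uA; apply/esym/invmx_uniq; rewrite -msubstM mulmxV // msubst1.
Qed.

Lemma msubst_unit A : A \in unitmx -> msubst X Y A \in unitmx.
Proof.
move=> uA; suff: msubst X Y A *m msubst X Y (invmx A) = 1%:M.
  by case/mulmx1_unit.
by rewrite -msubstM mulmxV // msubst1.
Qed.

Lemma mxeval_msubst (p : mpoly.mpoly (n * n) F) A :
  mxeval (@laurentC F) p (msubst X Y A) = lsubst X Y (mxeval (@laurentC F) p A).
Proof.
have [s e] := lsubst_rmorph uX uY; rewrite /mxeval /msubst /mpoly.mmap e.
rewrite rmorph_sum; apply: eq_bigr => m _.
rewrite rmorphM -[X in X * _ = _]mulr1 -[in LHS](mulr1 (laurentC _)).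
(* Constants are monomials of exponent (0, 0), so the substitution fixes the coefficients of [p]. *)
rewrite -e lsubst_lmonom !expr0z !mulr1 e /mpoly.mmap1 rmorph_prod.
congr (_ * _); apply: eq_bigr => i _.
by rewrite rmorphXn -map_mxvec mxE.
Qed.

(** The equations of G have coefficients in F, so they survive any F-algebra endomorphism; only the
    effect on the coefficient ring has to be checked. *)
Lemma points_msubst S S' A : (forall f, S f -> S' (lsubst X Y f)) ->
  points G S A -> points G S' (msubst X Y A).
Proof.
move=> SS' [uA SA SVA GA]; split=> [|i j|i j|p Gp].
- exact: msubst_unit.
- by rewrite mxE; exact: SS'.
- by rewrite -msubstV // mxE; exact: SS'.
- have [s e] := lsubst_rmorph uX uY.
  by rewrite mxeval_msubst GA // e rmorph0.
Qed.

End Msubst.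

Lemma lvt_unit : (lvt : L) \is a GRing.unit.
Proof. exact: lmonom_unit (oner_neq0 _). Qed.

Lemma lvu_unit : (lvu : L) \is a GRing.unit.
Proof. exact: lmonom_unit (oner_neq0 _). Qed.

Lemma scale_lvt_unit c : c != 0 -> laurentC c * lvt \is a GRing.unit.
Proof. by rewrite scale_lvt; exact: lmonom_unit. Qed.

Lemma scale_lvu_unit c : c != 0 -> laurentC c * lvu \is a GRing.unit.
Proof. by rewrite scale_lvu; exact: lmonom_unit. Qed.

Hint Resolve lvt_unit lvu_unit scale_lvt_unit scale_lvu_unit : core.

(** * Diagonal substitutions and the swap on points and kernels *)

Section Diagonal.
Variables c d : F.
Hypotheses (c0 : c != 0) (d0 : d != 0).
Local Notation D := (msubst (laurentC c * lvt) (laurentC d * lvu)).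

Lemma points_diag I J A : GL I J A -> GL I J (D A).
Proof.
apply: points_msubst; [exact: scale_lvt_unit|exact: scale_lvu_unit|].
move=> f If k; rewrite mcoeff_lsubst_diag // => fk; apply: If.
by apply: contraNneq fk => ->; rewrite !mul0r.
Qed.

(** A diagonal substitution multiplies each monomial by a scalar, so it commutes with every
    restriction of exponents, in particular with both specializations. *)
Lemma lrestr_diag P f :
  lrestr P (lsubst (laurentC c * lvt) (laurentC d * lvu) f) =
  lsubst (laurentC c * lvt) (laurentC d * lvu) (lrestr P f).
Proof.
apply/malgP => k; rewrite mcoeff_lrestr !mcoeff_lsubst_diag //.
by rewrite mcoeff_lrestr !mulrnAl.
Qed.

Lemma ker_t_diag A : ker_t A -> ker_t (D A).
Proof.
rewrite /ker_t /= => kA.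
rewrite -[RHS](msubst1 (scale_lvt_unit c0) (scale_lvu_unit d0)).
rewrite -{}kA; apply/matrixP => i j; rewrite !mxE; exact: lrestr_diag.
Qed.

Lemma ker_u_diag A : ker_u A -> ker_u (D A).
Proof.
rewrite /ker_u /= => kA.
rewrite -[RHS](msubst1 (scale_lvt_unit c0) (scale_lvu_unit d0)).
rewrite -{}kA; apply/matrixP => i j; rewrite !mxE; exact: lrestr_diag.
Qed.

End Diagonal.

Local Notation W := (msubst lvu lvt).

Lemma points_swap I J A : GL I J A -> GL J I (W A).
Proof.
apply: points_msubst => // f If k.
by rewrite mcoeff_lsubst_swap => /If[].
Qed.

Lemma tinv0_swap (f : L) : tinv0 (lsubst lvu lvt f) = lsubst lvu lvt (uinv0 f).
Proof.
apply/malgP => k; rewrite mcoeff_lsubst_swap.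
rewrite [LHS](mcoeff_lrestr (fun k => k.1 == 0)) mcoeff_lsubst_swap.
by rewrite [RHS](mcoeff_lrestr (fun k => k.2 == 0)).
Qed.

Lemma ker_t_swap A : ker_u A -> ker_t (W A).
Proof.
rewrite /ker_t /ker_u /= => kA; rewrite -[RHS](msubst1 lvu_unit lvt_unit).
by rewrite -{}kA; apply/matrixP => i j; rewrite !mxE tinv0_swap.
Qed.

Lemma ker_u_swap A : ker_t A -> ker_u (W A).
Proof.
rewrite /ker_t /ker_u /= => kA; rewrite -[RHS](msubst1 lvu_unit lvt_unit).
rewrite -{}kA; apply/matrixP => i j; rewrite !mxE.
(* The intertwining for [uinv0] is the one for [tinv0] conjugated by the involutive swap. *)
by rewrite -[in RHS](lsubst_swapK (A i j)) tinv0_swap lsubst_swapK.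
Qed.

(* Birkhoff factorizations are unique: the quotient of the two left factors
   involves no power of the specialized variable, so the specialization, which
   sends both left factors to 1, leaves the quotient unchanged. *)
Lemma lrestr_factor_uniq P S S' A A' B B' :
  (forall C D : 'M[L]_n, (forall i j, S (C i j)) -> (forall i j, S (D i j)) ->
    forall i j, S ((C *m D) i j)) ->
  (forall C D : 'M[L]_n, (forall i j, S' (C i j)) -> (forall i j, S' (D i j)) ->
    forall i j, S' ((C *m D) i j)) ->
  (forall f, S f -> S' f -> forall k l, f@_l != 0 -> P (k + l) = P k) ->
  points G S A -> points G S B -> points G S' A' -> points G S' B' ->
  map_mx (lrestr P) A = 1%:M -> map_mx (lrestr P) B = 1%:M ->
  A *m A' = B *m B' -> A = B.
Proof.
move=> SM S'M SS' [uA SA _ _] [uB _ SVB _] [uA' _ SVA' _] [uB' SB' _ _].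
move=> kA kB AB.
pose Q := invmx B *m A.
(* The definition of [Q] places its entries in [S]; this second expression places them in [S']. *)
have QE : Q = B' *m invmx A'.
  by rewrite /Q -[in LHS](mulmxK uA' A) AB !mulmxA mulVmx // mul1mx.
have ABQ : A = B *m Q by rewrite mulmxA mulmxV // mul1mx.
have inertQ i j : forall k l, (Q i j)@_l != 0 -> P (k + l) = P k.
  apply: SS'; last by rewrite QE; exact: S'M.
  exact: SM.
(* Specializing A = BQ turns both A and B into 1 and leaves Q as it is. *)
have Q1 : Q = 1%:M.
  by rewrite -[LHS]mul1mx -[X in X *m _]kB -lrestr_mulmx // -ABQ.
by rewrite ABQ Q1 mulmx1.
Qed.

Lemma birkhoff_uniq_t A A' B B' :
  (GL eneg eneg `&` ker_t (n := n)) A -> (GL eneg eneg `&` ker_t (n := n)) B ->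
  GL epos eneg A' -> GL epos eneg B' -> A *m A' = B *m B' -> A = B.
Proof.
move=> [GA kA] [GB kB] GA' GB'.
apply: (lrestr_factor_uniq (P := fun k => k.1 == 0)) GA GB GA' GB' kA kB.
- by move=> C D; apply: lring_mulmx; exact: addclosed_eneg.
- move=> C D; apply: lring_mulmx; [exact: addclosed_epos|exact: addclosed_eneg].
move=> f Nf Pf k l fl; have [+ _] := Nf l fl; have [+ _] := Pf l fl.
rewrite /epos /eneg => l_ge0 l_le0; have l0 : l.1 = 0.
  by apply/eqP; rewrite eq_le l_le0.
by rewrite -[(k + l).1]/(k.1 + l.1) l0 addr0.
Qed.

(** The swap exchanges the two variables and reduces this to [birkhoff_uniq_t]. *)
Lemma birkhoff_uniq_u A A' B B' :
  (GL eneg eneg `&` ker_u (n := n)) A -> (GL eneg eneg `&` ker_u (n := n)) B ->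
  GL eneg epos A' -> GL eneg epos B' -> A *m A' = B *m B' -> A = B.
Proof.
have swap C : (GL eneg eneg `&` ker_u (n := n)) C ->
    (GL eneg eneg `&` ker_t (n := n)) (W C).
  by move=> [GC kC]; split; [exact: points_swap|exact: ker_t_swap].
move=> /swap GA /swap GB /points_swap GA' /points_swap GB' AB.
have WK : involutive (W : 'M[L]_n -> 'M[L]_n).
  by move=> C; apply/matrixP => i j; rewrite !mxE lsubst_swapK.
apply: (inv_inj WK); apply: birkhoff_uniq_t GA GB GA' GB' _.
by rewrite -!msubstM // AB.
Qed.

(** * The substitution of tu for t *)

Lemma tuE : lvt * lvu = lmonom 1 (1, 1) :> L.
Proof. by rewrite /lvt /lvu lmonomM mulr1. Qed.

(** The monomial t^i u^j goes to t^i u^(i+j): the substitution is a shear of the exponent lattice,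
    hence invertible. *)
Lemma mcoeff_lsubst_tu (f : L) k :
  (lsubst (lvt * lvu) lvu f)@_k = f@_(k.1, k.2 - k.1).
Proof.
have [r ->] := laurent_sum f.
rewrite lsubst_sum !raddf_sum; apply: eq_bigr => -[e m] _ /=.
rewrite tuE /lvu lsubst_lmonomE ?oner_eq0 // !mcoeff_lmonom !pair_mulrz /=.
rewrite !exp1rz !mulr1; congr (_ *+ nat_of_bool _).
rewrite !mul0r !mul1r; case: m k => i j [i' j'].
rewrite -[_ + _]/(i + 0, i + j) addr0 !xpair_eqE /=.
by have [->|//] := eqVneq i i'; rewrite /= [RHS]eq_sym subr_eq addrC eq_sym.
Qed.

Lemma tu_unit : (lvt * lvu : L) \is a GRing.unit.
Proof. by rewrite unitrM lvt_unit lvu_unit. Qed.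

Local Notation T := (msubst (lvt * lvu) lvu).

Lemma msubst_tu_inj : injective (T : 'M[L]_n -> 'M[L]_n).
Proof.
move=> A B /matrixP AB; apply/matrixP => i j; apply/malgP => k.
(* The exponent compared is the image of [k] under the shear. *)
have /(congr1 (mcoeff (k.1, k.2 + k.1))) := AB i j.
by rewrite !mxE !mcoeff_lsubst_tu /= addrK -surjective_pairing.
Qed.

(** Exhibits rescaling as a diagonal substitution, so that the lemmas on those apply. *)
Lemma rescaleE c A :
  rescale c A = msubst (laurentC c^-1 * lvt) (laurentC 1 * lvu) A.
Proof. by rewrite /rescale rmorph1 mul1r. Qed.

(** The entries of [A] do not involve u, so after tu replaces t only the monomials (tu)^i occur, and
    the diagonal substitution scales them by (ab)^(-i). *)
Lemma diag_msubst_tu I a b A : a != 0 -> b != 0 ->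
  (forall i j, lring I enul (A i j)) ->
  msubst (laurentC a^-1 * lvt) (laurentC b^-1 * lvu) (T A) =
  T (rescale (a * b) A).
Proof.
move=> a0 b0 IA; rewrite rescaleE; apply/matrixP => i j; rewrite !mxE.
apply/malgP => k; rewrite mcoeff_lsubst_diag ?invr_eq0 // !mcoeff_lsubst_tu.
rewrite mcoeff_lsubst_diag ?invr_eq0 ?mulf_neq0 ?oner_eq0 //=.
have [->|fk] := eqVneq (A i j)@_(k.1, k.2 - k.1) 0; first by rewrite !mul0r.
have [_ /eqP] := IA i j _ fk; rewrite /= => /eqP; rewrite subr_eq0 => /eqP ->.
by rewrite subrr expr0z mulr1 invfM expfzMl mulrA.
Qed.

(** For entries free of u the result is a Laurent polynomial in tu, which is symmetric in t and
    u. *)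
Lemma swap_msubst_tu I A : (forall i j, lring I enul (A i j)) -> W (T A) = T A.
Proof.
move=> IA; apply/matrixP => i j; rewrite !mxE.
apply/malgP => k; rewrite mcoeff_lsubst_swap !mcoeff_lsubst_tu /=.
have [<-//|k12] := eqVneq k.1 k.2.
have A0 l : l.2 != 0 -> (A i j)@_l = 0.
  by move=> l0; apply: contraNeq l0 => /IA[].
by rewrite !A0 //= subr_eq0 // eq_sym.
Qed.

(** * Uniqueness and transformation of the factorizations *)

(** This lets a value of Psi be computed from any factorization of any representative. *)
Lemma factors_uniq z A B : factors G z A -> factors G z B -> A = B.
Proof.
move=> [a [a' [b [b' [[Ga Ga' za] [[Gb Gb' zb] abA]]]]]].
move=> [c [c' [d [d' [[Gc Gc' zc] [[Gd Gd' zd] cdB]]]]]].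
have ac : a = c.
  case: Ga Gc Ga' Gc' => Ga [ka _] [Gc [kc _]] [Ga' _] [Gc' _].
  by apply: birkhoff_uniq_t Ga' Gc' _ => //; rewrite -za.
have bd : b = d.
  case: Gb Gd Gb' Gd' => Gb [_ kb] [Gd [_ kd]] [Gb' _] [Gd' _].
  by apply: birkhoff_uniq_u Gb' Gd' _ => //; rewrite -zb.
by apply: msubst_tu_inj; rewrite -abA -cdB ac bd.
Qed.

Lemma factors_diag I a b z A : a != 0 -> b != 0 ->
  (forall i j, lring I enul (A i j)) ->
  factors G z A -> factors G (diag_act a b z) (rescale (a * b) A).
Proof.
move=> a0 b0 IA [p [p' [q [q' [[[Gp [tp up]] [Gp' up'] zp]]]]]].
move=> [[[Gq [tq uq]] [Gq' tq'] zq] pqA].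
have [a'0 b'0] : a^-1 != 0 /\ b^-1 != 0 by rewrite !invr_eq0.
have [uX uY] := (scale_lvt_unit a'0, scale_lvu_unit b'0).
pose D : 'M[L]_n -> 'M[L]_n :=
  msubst (laurentC a^-1 * lvt) (laurentC b^-1 * lvu).
exists (D p), (D p'), (D q), (D q').
split; first split.
- by split; [exact: points_diag|split; [exact: ker_t_diag|exact: ker_u_diag]].
- by split; [exact: points_diag|exact: ker_u_diag].
- by rewrite /= zp msubstM.
split; first split.
- by split; [exact: points_diag|split; [exact: ker_t_diag|exact: ker_u_diag]].
- by split; [exact: points_diag|exact: ker_t_diag].
- by rewrite /= zq msubstM.
case: Gp => [unitp _ _ _].
rewrite -msubstV // -msubstM // pqA.
by rewrite (diag_msubst_tu a0 b0 IA).
Qed.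

(** Exchanging the left factors p and q replaces p^-1 q by q^-1 p, its inverse, up to the swap of t
    and u, which fixes elements expressed in tu. *)
Lemma factors_swap I z A : GL I enul A ->
  factors G z A -> factors G (swap_act z) (invmx A).
Proof.
move=> [uA IA _ _] [p [p' [q [q' [[[Gp [tp up]] [Gp' up'] zp]]]]]].
move=> [[[Gq [tq uq]] [Gq' tq'] zq] pqA].
exists (W q), (W q'), (W p), (W p').
split; first split.
- by split; [exact: points_swap|split; [exact: ker_t_swap|exact: ker_u_swap]].
- by split; [exact: points_swap|exact: ker_u_swap].
- by rewrite /= zq msubstM.
split; first split.
- by split; [exact: points_swap|split; [exact: ker_t_swap|exact: ker_u_swap]].
- by split; [exact: points_swap|exact: ker_t_swap].
- by rewrite /= zp msubstM.
case: Gp Gq => [+ _ _ _] [+ _ _ _] => unitp unitq.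
rewrite -msubstV // -msubstM // msubstV ?tu_unit // -(swap_msubst_tu IA).
rewrite -msubstV ?msubst_unit ?tu_unit // -pqA invmx_mul ?unitmx_inv //.
by rewrite invmxK.
Qed.

(** * The action on orbits and on the fixed-point set *)

Lemma points_unit S A : points G S A -> A \in unitmx.
Proof. by case. Qed.

(** The substitution normalizes the gauge group. The new gauge depends on [h] alone and serves every
    quadruple, so the relation can later be applied at a transformed quadruple. *)
Lemma diag_act_Hact a b h : a != 0 -> b != 0 -> Hset G h ->
  exists2 h', Hset G h' &
    forall z, diag_act a b (Hact h z) = Hact h' (diag_act a b z).
Proof.
move=> a0 b0; have [a'0 b'0] : a^-1 != 0 /\ b^-1 != 0 by rewrite !invr_eq0.
have [uX uY] := (scale_lvt_unit a'0, scale_lvu_unit b'0).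
case: h => x00 x01 x10 x11 [/= G00 [G01 k01] [G10 k10] [G11 [kt11 ku11]]].
pose D : 'M[L]_n -> 'M[L]_n :=
  msubst (laurentC a^-1 * lvt) (laurentC b^-1 * lvu).
exists (Gauge (D x00) (D x01) (D x10) (D x11)).
  split => /=; first exact: points_diag.
  - by split; [exact: points_diag|exact: ker_u_diag].
  - by split; [exact: points_diag|exact: ker_t_diag].
  - by split; [exact: points_diag|split; [exact: ker_t_diag|exact: ker_u_diag]].
move=> z; rewrite /Hact /diag_act /= !msubstM //.
by rewrite !msubstV // ?(points_unit G00) ?(points_unit G01) ?(points_unit G10).
Qed.

Lemma swap_act_Hact h : Hset G h ->
  exists2 h', Hset G h' & forall z, swap_act (Hact h z) = Hact h' (swap_act z).
Proof.
case: h => x00 x01 x10 x11 [/= G00 [G01 k01] [G10 k10] [G11 [kt11 ku11]]].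
exists (Gauge (W x00) (W x10) (W x01) (W x11)).
  split => /=; first exact: points_swap.
  - by split; [exact: points_swap|exact: ker_u_swap].
  - by split; [exact: points_swap|exact: ker_t_swap].
  - by split; [exact: points_swap|split; [exact: ker_t_swap|exact: ker_u_swap]].
move=> z; rewrite /Hact /swap_act /= !msubstM //.
by rewrite !msubstV // ?(points_unit G00) ?(points_unit G01) ?(points_unit G10).
Qed.

Lemma N_act_Hact M h : NGm M -> Hset G h ->
  exists2 h', Hset G h' & forall z, N_act M (Hact h z) = Hact h' (N_act M z).
Proof.
move=> [a [b [a0 b0 [->|->]]]] Hh.
  have [h' Hh' E] := diag_act_Hact a0 b0 Hh.
  by exists h' => // z; rewrite !N_act_diag.
have [h1 Hh1 E1] := swap_act_Hact Hh.
have [h' Hh' E] := diag_act_Hact a0 b0 Hh1.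
by exists h' => // z; rewrite !N_act_antidiag //= E1.
Qed.

Lemma Zset_diag a b z : a != 0 -> b != 0 -> Zset G z -> Zset G (diag_act a b z).
Proof.
move=> a0 b0 [G01 G10 [G1 k1] [G2 k2] E].
have [a'0 b'0] : a^-1 != 0 /\ b^-1 != 0 by rewrite !invr_eq0.
have [uX uY] := (scale_lvt_unit a'0, scale_lvu_unit b'0).
split => /=; [exact: points_diag|exact: points_diag| | |].
- by split; [exact: points_diag|exact: ker_u_diag].
- by split; [exact: points_diag|exact: ker_t_diag].
- by rewrite -!msubstM // E.
Qed.

Lemma Zset_swap z : Zset G z -> Zset G (swap_act z).
Proof.
move=> [G01 G10 [G1 k1] [G2 k2] E].
split => /=; [exact: points_swap|exact: points_swap| | |].
- by split; [exact: points_swap|exact: ker_u_swap].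
- by split; [exact: points_swap|exact: ker_t_swap].
- by rewrite -!msubstM // E.
Qed.

Lemma Zset_N_act M z : NGm M -> Zset G z -> Zset G (N_act M z).
Proof.
move=> [a [b [a0 b0 [->|->]]]] Zz.
  by rewrite N_act_diag; exact: Zset_diag.
by rewrite N_act_antidiag //=; apply: Zset_diag => //; exact: Zset_swap.
Qed.

Lemma NGm_inv M : NGm M -> exists2 M', NGm M' & M *m M' = 1%:M.
Proof.
have mx2_1 : mx2 1 0 0 1 = 1%:M :> 'M[F]_2.
  apply/matrixP => i j; rewrite !mxE -val_eqE.
  by case: i j => -[|[|//]] ? [[|[|//]] ?].
move=> [a [b [a0 b0 [->|->]]]].
  exists (mx2 a^-1 0 0 b^-1).
    by exists a^-1, b^-1; rewrite !invr_eq0; split => //; left.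
  by rewrite mx2M !(mulr0, mul0r, addr0, add0r) !mulfV.
exists (mx2 0 b^-1 a^-1 0).
  by exists b^-1, a^-1; rewrite !invr_eq0; split => //; right.
by rewrite mx2M !(mulr0, mul0r, addr0, add0r) !mulfV.
Qed.

Lemma N_orb_Horbit M z : NGm M -> N_orb M (Horbit G z) = Horbit G (N_act M z).
Proof.
move=> NM; apply/seteqP; split=> [_ [_ [h Hh <-] <-]|_ [h Hh <-]].
  by have [h' Hh' ->] := N_act_Hact NM Hh; exists h'.
(* For the reverse inclusion the gauge [h] is pulled back by the inverse of [M]. *)
have [M' NM' MM'] := NGm_inv NM.
have [h' Hh' E] := N_act_Hact NM' Hh.
exists (Hact h' z); first by exists h'.
rewrite -[in LHS](N_act1 z) -(mulmx1C MM') (N_actM _ NM' NM) -E -N_actM //.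
by rewrite MM' N_act1.
Qed.

Lemma N_orbM M M' (O : set (quad F n)) : NGm M -> NGm M' ->
  N_orb (M *m M') O = N_orb M (N_orb M' O).
Proof.
move=> NM NM'; rewrite /N_orb image_comp.
by apply: eq_imagel => z _; rewrite N_actM.
Qed.

(** The fixed-point set is stable because [NGm] normalizes the torus: diagonal matrices centralize
    it, while antidiagonal ones exchange c and c^-1. *)
Lemma BunA2Gm_N_orb M (O : set (quad F n)) :
  NGm M -> BunA2Gm G O -> BunA2Gm G (N_orb M O).
Proof.
move=> NM [[z Zz <-] fixO]; split.
  by rewrite N_orb_Horbit //; exists (N_act M z) => //; exact: Zset_N_act.
move=> c c0; have Gm (d : F) : d != 0 -> NGm (mx2 d 0 0 d^-1).
  by move=> d0; exists d, d^-1; rewrite invr_eq0; split => //; left.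
have [d d0 cMd] : exists2 d, d != 0 &
    mx2 c 0 0 c^-1 *m M = M *m mx2 d 0 0 d^-1.
  case: NM => a [b [_ _ [->|->]]]; [exists c|exists c^-1].
  - by [].
  - by rewrite !mx2M !(mulr0, mul0r, addr0, add0r) !(mulrC c, mulrC c^-1).
  - by rewrite invr_eq0.
  - by rewrite !mx2M !(mulr0, mul0r, addr0, add0r) invrK !(mulrC c, mulrC c^-1).
rewrite -N_orbM //; last exact: Gm.
by rewrite cMd N_orbM //; [rewrite fixO|exact: Gm].
Qed.

(** * Transport of the action along Psi *)

(** Reduces the computation of the transported action to a statement about factorizations of single
    quadruples. Membership of [B] in [Gr0] comes for free, since [B] is a value of Psi. *)
Lemma transportedE (Psi : set (quad F n) -> 'M[L]_n) M A B :
  BF_bijection G Psi -> NGm M -> Gr0 G A ->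
  (forall z, factors G z A -> factors G (N_act M z) B) ->
  transported G Psi M A = B /\ Gr0 G B.
Proof.
move=> [[PsiGr _ Psi_surj] Psi_factors] NM GA AB.
suff [TB GT] : transported G Psi M A = B /\ Gr0 G (transported G Psi M A).
  by split => //; rewrite -TB.
have [O OGm OA] := Psi_surj A GA.
(* Surjectivity makes the fibre nonempty, so [xget] returns a point of it and not its default. *)
have : (BunA2Gm G `&` Psi @^-1` [set A]) (BF_inverse G Psi A).
  by apply: xgetPex; exists O.
rewrite /transported => -[]; move: (BF_inverse G Psi A) => O' O'Gm PsiO'.
case: (O'Gm) => -[z Zz zO'] _; move: O'Gm PsiO'; rewrite -{}zO' => zGm Psiz.
have NzGm := BunA2Gm_N_orb NM zGm.
split; last exact: PsiGr.
rewrite N_orb_Horbit // in NzGm *.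
apply: factors_uniq (Psi_factors _ (Zset_N_act NM Zz) NzGm) _.
by apply: AB; rewrite -Psiz; exact: Psi_factors.
Qed.

Lemma transported_diag (Psi : set (quad F n) -> 'M[L]_n) a b A :
  BF_bijection G Psi -> a != 0 -> b != 0 -> Gr0 G A ->
  transported G Psi (mx2 a 0 0 b) A = rescale (a * b) A.
Proof.
move=> BF a0 b0 GA; have NM : NGm (mx2 a 0 0 b).
  by exists a, b; split => //; left.
have [//|//] := transportedE (B := rescale (a * b) A) BF NM GA.
move=> z zA; rewrite N_act_diag; case: GA => -[_ IA _ _] _.
exact: factors_diag IA zA.
Qed.

(** The matrix is the swap followed by diag(a, b), so inversion is followed by rescaling. Entries
    (1, 1) give the swap itself, and (1, -1) the element of SL(2) inducing the involution. *)
Lemma transported_antidiag (Psi : set (quad F n) -> 'M[L]_n) a b A :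
  BF_bijection G Psi -> a != 0 -> b != 0 -> Gr0 G A ->
  transported G Psi (mx2 0 a b 0) A = rescale (a * b) (invmx A) /\
  Gr0 G (rescale (a * b) (invmx A)).
Proof.
move=> BF a0 b0 GA; apply: (transportedE BF _ GA).
  by exists a, b; split => //; right.
move=> z zA; rewrite N_act_antidiag //=; case: GA => GA _.
have IV : forall i j, lring eneg enul (invmx A i j) by case: GA.
exact: factors_diag a0 b0 IV (factors_swap GA zA).
Qed.

Lemma rescale1 A : rescale 1 A = A.
Proof.
apply/matrixP => i j.
by rewrite mxE invr1 rmorph1 mul1r lsubst_id.
Qed.

Lemma rescaleM c d A : c != 0 -> d != 0 ->
  rescale c (rescale d A) = rescale (c * d) A.
Proof.
move=> c0 d0; rewrite !rescaleE; apply/matrixP => i j; rewrite !mxE.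
by rewrite lsubst_diagM ?invr_eq0 ?oner_eq0 // mulr1 -invfM.
Qed.

Lemma rescaleV c A : c != 0 -> A \in unitmx ->
  rescale c (invmx A) = invmx (rescale c A).
Proof.
by move=> c0 uA; rewrite /rescale msubstV // scale_lvt_unit // invr_eq0.
Qed.

(** Inversion commutes with rescaling, and rescaling twice by -1 is the identity. *)
Lemma Gr_iotaK A : A \in unitmx -> Gr_iota (Gr_iota A) = A.
Proof.
have N1 : (-1 : F) != 0 by rewrite oppr_eq0 oner_eq0.
move=> uA; rewrite /Gr_iota -(rescaleV N1 uA) rescaleM //.
by rewrite mulrNN mulr1 rescale1 invmxK.
Qed.

End Matrices.

Theorem theorem1p1 (R : realType) (n : nat) (G : set 'M[R[i]]_n)
    (Gss : semisimple G) (Gsc : simply_connected G)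
    (Psi : set (quad R[i] n) -> 'M[laurent R[i]]_n)
    (hPsi : BF_bijection G Psi) :
  [/\ forall alpha beta : R[i], alpha != 0 -> beta != 0 ->
        forall g, Gr0 G g ->
          transported G Psi (mx2 alpha 0 0 beta) g
            = rescale (alpha * beta) g,
      forall g, Gr0 G g ->
        transported G Psi (mx2 0 1 1 0) g = invmx g,
      forall g, Gr0 G g ->
        transported G Psi (mx2 0 1 (-1) 0) g = Gr_iota g &
      forall g, Gr0 G g -> Gr0 G (Gr_iota g) /\ Gr_iota (Gr_iota g) = g].
Proof.
have N1 : (-1 : R[i]) != 0 by rewrite oppr_eq0 oner_eq0.
have iotaE g : Gr0 G g -> rescale (1 * -1) (invmx g) = Gr_iota g.
  by move=> [[ug _ _ _] _]; rewrite mul1r rescaleV.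
split=> [alpha beta a0 b0 g Gg|g Gg|g Gg|g Gg].
- exact: transported_diag.
- have [-> _] := transported_antidiag hPsi (oner_neq0 _) (oner_neq0 _) Gg.
  by rewrite mulr1 rescale1.
- have [-> _] := transported_antidiag hPsi (oner_neq0 _) N1 Gg.
  exact: iotaE.
- (* iota preserves Gr0 because it is transported from an action on the
     bundles and Psi takes its values in Gr0. *)
  split; last by apply: Gr_iotaK; case: Gg => -[].
  rewrite -iotaE //.
  exact: (transported_antidiag hPsi (oner_neq0 _) N1 Gg).2.
Qed.
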